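(* Let $\lambda/\mu$ be a skew shape (partitions $\mu\subseteq\lambda$). Then $$\sum_{\pi\in \mathrm{RPP}(\lambda/\mu)} q^{|\pi|}\;=\;\sum_{S\in\mathcal{P}(\lambda/\mu)}\ \prod_{u\in S}\frac{q^{h(u)}}{1-q^{h(u)}},$$ where $\mathcal{P}(\lambda/\mu)$ is the set of pleasant diagrams of $\lambda/\mu$.
   Context: $[\lambda]=\{(i,j):1\le i\le \ell(\lambda),\,1\le j\le\lambda_i\}$ is the Young diagram (rows numbered from the top, columns from the left), $\lambda'$ is the conjugate partition, and $h(i,j)=\lambda_i-i+\lambda'_j-j+1$ is the hook-length in $\lambda$. $\mathrm{RPP}(\lambda/\mu)$ is the set of reverse plane partitions of shape $\lambda/\mu$: fillings $\pi$ of the cells of $[\lambda]\setminus[\mu]$ with nonnegative integers, weakly increasing along rows and down columns; $|\pi|$ is the sum of the entries. Pleasant diagrams: for an integer $k$ with $1-\ell(\lambda)\le k\le\lambda_1-1$, let $\mathsf{d}_k=\{(i,j)\in[\lambda]\setminus[\mu]: j-i=k\}$, let $s_k=|\mathsf{d}_k|$, and let $\square_k^\lambda$ be the largest rectangle with $i$ rows and $i+k$ columns, with northwest corner $(1,1)$, that fits inside $[\lambda]$. A descending chain of length $s$ in a set of cells is a sequence of cells $(i_1,j_1),\ldots,(i_s,j_s)$ of the set with $i_1<\cdots<i_s$ and $j_1<\cdots<j_s$. A subset $S\subseteq[\lambda]$ is a pleasant diagram of $\lambda/\mu$ if for every $k$ with $1-\ell(\lambda)\le k\le\lambda_1-1$,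 every descending chain in $S\cap\square_k^\lambda$ has length at most $s_k$. *)

(* Defs.v *)
From HB Require Import structures.
From mathcomp Require Import all_boot all_order all_algebra.
From mathcomp Require Import boolp classical_sets.

Set Implicit Arguments.
Unset Strict Implicit.
Unset Printing Implicit Defensive.

Import Order.TTheory GRing.Theory Num.Theory.

Local Open Scope ring_scope.

(* Formal power series in one variable q: fcoef f n is the coefficient of q^n. *)

Record fps (R : Type) := Fps { fcoef : nat -> R }.

Lemma fpsP (R : Type) (f g : fps R) : fcoef f =1 fcoef g -> f = g.
Proof. by case: f => f; case: g => g /= /funext ->. Qed.

HB.instance Definition _ (R : Type) := gen_eqMixin (fps R).
HB.instance Definition _ (R : Type) := gen_choiceMixin (fps R).

Section FpsZmodule.
Variable R : zmodType.
Implicit Types f g : fps R.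

Definition fps_zero : fps R := Fps (fun _ => 0).
Definition fps_opp f : fps R := Fps (fun n => - fcoef f n).
Definition fps_add f g : fps R := Fps (fun n => fcoef f n + fcoef g n).

Fact fps_addA : associative fps_add.
Proof. by move=> f g h; apply: fpsP => n /=; rewrite addrA. Qed.
Fact fps_addC : commutative fps_add.
Proof. by move=> f g; apply: fpsP => n /=; rewrite addrC. Qed.
Fact fps_add0 : left_id fps_zero fps_add.
Proof. by move=> f; apply: fpsP => n /=; rewrite add0r. Qed.
Fact fps_addN : left_inverse fps_zero fps_opp fps_add.
Proof. by move=> f; apply: fpsP => n /=; rewrite addNr. Qed.

HB.instance Definition _ :=
  GRing.isZmodule.Build (fps R) fps_addA fps_addC fps_add0 fps_addN.

End FpsZmodule.

Section FpsRing.
Variable R : comNzRingType.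
Implicit Types f g : fps R.

Definition fps_one : fps R := Fps (fun n => (n == 0)%:R).
Definition fps_mul f g : fps R :=
  Fps (fun n => \sum_(i < n.+1) fcoef f i * fcoef g (n - i)).

Let trunc n f : {poly R} := \poly_(i < n.+1) fcoef f i.

Let coef_trunc n m f : (m <= n)%N -> (trunc n f)`_m = fcoef f m.
Proof. by move=> le_mn; rewrite coef_poly ltnS le_mn. Qed.

Let coef_mul n m f g :
  (m <= n)%N -> fcoef (fps_mul f g) m = (trunc n f * trunc n g)`_m.
Proof.
move=> le_mn; rewrite coefM; apply: eq_bigr => i _.
rewrite !coef_trunc //; first exact: leq_trans (leq_subr _ _) le_mn.
by apply: leq_trans le_mn; rewrite -ltnS.
Qed.

Fact fps_mulA : associative fps_mul.
Proof.
move=> f g h; apply: fpsP => n.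
transitivity ((trunc n f * (trunc n g * trunc n h))`_n).
  rewrite coefM; apply: eq_bigr => i _.
  have le_in : (i <= n)%N by rewrite -ltnS.
  by rewrite (coef_trunc f le_in) -(coef_mul g h (leq_subr i n)).
rewrite mulrA coefM; apply: eq_bigr => i _.
have le_in : (i <= n)%N by rewrite -ltnS.
by rewrite (coef_trunc h (leq_subr i n)) -(coef_mul f g le_in).
Qed.

Fact fps_mulC : commutative fps_mul.
Proof.
by move=> f g; apply: fpsP => n; rewrite !(coef_mul _ _ (leqnn n)) mulrC.
Qed.

Fact fps_mul1 : left_id fps_one fps_mul.
Proof.
move=> f; apply: fpsP => n /=; rewrite big_ord_recl /= subn0 mul1r.
by rewrite big1 ?addr0 // => i _; rewrite mul0r.
Qed.

Fact fps_mulD : left_distributive fps_mul +%R.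
Proof.
move=> f g h; apply: fpsP => n /=; rewrite -big_split /=.
by apply: eq_bigr => i _; rewrite mulrDl.
Qed.

Fact fps_one_neq0 : fps_one != 0.
Proof.
by apply/eqP => /(congr1 (fun f => fcoef f 0)) /eqP; rewrite /= oner_eq0.
Qed.

HB.instance Definition _ := GRing.Zmodule_isComNzRing.Build (fps R)
  fps_mulA fps_mulC fps_mul1 fps_mulD fps_one_neq0.

Definition fps_unit : {pred fps R} := [pred f | `[< exists g, g * f = 1 >]].
Definition fps_inv f : fps R := xget f [set g | g * f = 1].

Fact fps_mulV : {in fps_unit, left_inverse 1 fps_inv *%R}.
Proof. by move=> f /asboolP /(xgetPex f). Qed.
Fact fps_unitP f g : g * f = 1 -> fps_unit f.
Proof. by move=> gf1; apply/asboolP; exists g. Qed.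
Fact fps_inv_out : {in [predC fps_unit], fps_inv =1 id}.
Proof.
move=> f /negP f_nunit; apply: xgetPN => g gf1.
by apply: f_nunit; exact: fps_unitP gf1.
Qed.

HB.instance Definition _ := GRing.ComNzRing_hasMulInverse.Build (fps R)
  fps_mulV fps_unitP fps_inv_out.

Definition fpsX : fps R := Fps (fun n => (n == 1)%:R).

Lemma fcoefXn h n : fcoef (fpsX ^+ h) n = (n == h)%:R.
Proof.
elim: h n => [|h IHh] n; first by rewrite expr0.
rewrite exprS /=; case: n => [|n].
  by rewrite big_ord1 /= mul0r.
rewrite 2!big_ord_recl big1 /= => [|i _]; last by rewrite mul0r.
by rewrite mul0r mul1r add0r addr0 IHh subSS subn0 eqSS.
Qed.

Lemma fcoefXnM h f n :
  fcoef (fpsX ^+ h * f) n = if (h <= n)%N then fcoef f (n - h) else 0.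
Proof.
rewrite /=; under eq_bigr => i _ do rewrite fcoefXn.
case: leqP => [le_hn | lt_nh].
  have lt_hn : (h < n.+1)%N by [].
  rewrite (bigD1 (Ordinal lt_hn)) //= eqxx mul1r big1 ?addr0 // => i ne_ih.
  suff /negbTE-> : (i : nat) != h by rewrite mul0r.
  by apply: contra ne_ih => /eqP ih; apply/eqP/val_inj.
rewrite big1 // => i _; suff /negbTE-> : (i : nat) != h by rewrite mul0r.
by rewrite neq_ltn (leq_trans (ltn_ord i)).
Qed.

(* Hence [_ / (1 - fpsX ^+ h)] is a genuine quotient for every [h > 0]. *)
Lemma unit_1subXn h : (0 < h)%N -> (1 - fpsX ^+ h) \is a GRing.unit.
Proof.
move=> h_gt0; pose g : fps R := Fps (fun n => (h %| n)%N%:R).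
apply/unitrPr; exists g; rewrite mulrBl mul1r; apply: fpsP => n.
have -> : fcoef (g - fpsX ^+ h * g) n = fcoef g n - fcoef (fpsX ^+ h * g) n.
  by [].
rewrite fcoefXnM /=; case: leqP => [le_hn | lt_nh].
  rewrite dvdn_subl // subrr.
  by rewrite -(subnK le_hn) addn_eq0 (gtn_eqF h_gt0) andbF.
rewrite subr0; case: n lt_nh => [|n] lt_nh; first by rewrite dvdn0.
by rewrite gtnNdvd.
Qed.

(* Summation in the ring of formal power series: each coefficient of the family
   F is nonzero at only finitely many indices, listed by r, and these nonzero
   coefficients add up to the coefficient of s. *)
Definition fps_sums (I : eqType) (F : I -> fps R) (s : fps R) : Prop :=
  forall n : nat, exists r : seq I,
    [/\ uniq r, forall i, (i \in r) = (fcoef (F i) n != 0)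
      & \sum_(i <- r) fcoef (F i) n = fcoef s n].

End FpsRing.

Arguments fpsX {R}.

(* A partition is its list of (positive) parts, so its length is its [size] and
   its largest part is its [head 0].  Cells are indexed from 0: the ordinals
   (i, j) stand for the cell (i + 1, j + 1), with i the row and j the column. *)

Definition is_partition (lam : seq nat) : bool :=
  sorted geq lam && (0%N \notin lam).

Definition part_incl (mu lam : seq nat) : Prop :=
  forall i : nat, (nth 0 mu i <= nth 0 lam i)%N.

Definition conj_part (lam : seq nat) (j : nat) : nat :=
  count (fun x => j < x)%N lam.

Definition in_diag (lam : seq nat) (i j : nat) : bool := (j < nth 0 lam i)%N.

(* The bounding rectangle of the diagram of lam. *)
Notation box lam := ('I_(size lam) * 'I_(head 0%N lam))%type.

Definition diag (lam : seq nat) : {set box lam} :=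
  [set u : box lam | in_diag lam u.1 u.2].

Definition skew_diag (lam mu : seq nat) : {set box lam} :=
  [set u in diag lam | ~~ in_diag mu u.1 u.2].

(* The subtraction does not truncate on the cells of lam. *)
Definition hook (lam : seq nat) (u : box lam) : nat :=
  (nth 0 lam u.1 + conj_part lam u.2 + 1 - (u.1.+1 + u.2.+1))%N.

Section ReversePlanePartitions.
Variables lam mu : seq nat.

Definition skew_cell : Type := {u : box lam | u \in skew_diag lam mu}.

Definition is_rpp (pi : {ffun skew_cell -> nat}) : Prop :=
  (forall u v : skew_cell, (val u).1 = (val v).1 ->
     ((val u).2 <= (val v).2)%N -> (pi u <= pi v)%N)
  /\ (forall u v : skew_cell, (val u).2 = (val v).2 ->
     ((val u).1 <= (val v).1)%N -> (pi u <= pi v)%N).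

Definition rpp : Type := {p : {ffun skew_cell -> nat} | `[< is_rpp p >]}.

Definition rpp_size (pi : rpp) : nat := (\sum_(u : skew_cell) val pi u)%N.

End ReversePlanePartitions.

Section Pleasant.
Variables lam mu : seq nat.

Definition content (u : box lam) : int := (u.2 : nat)%:Z - (u.1 : nat)%:Z.

Definition skew_diagonal (k : int) : {set box lam} :=
  [set u in skew_diag lam mu | content u == k].

Definition rect_fits (a b : nat) : bool :=
  [forall i : 'I_a, forall j : 'I_b, in_diag lam i j].

(* The number of rows of the largest rectangle with i rows and i + k columns
   that fits inside lam; rows beyond the length of lam cannot be used. *)
Definition square_rows (k : int) : nat :=
  \max_(i < (size lam).+1 | (0 <= i%:Z + k) && rect_fits i `|(i%:Z + k)%R|%N) i.

Definition square (k : int) : {set box lam} :=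
  [set u : box lam | (u.1 < square_rows k)%N
                   & (u.2 : nat)%:Z < (square_rows k)%:Z + k].

Definition desc_chain (T : {set box lam}) (s : seq (box lam)) : bool :=
  all (mem T) s && sorted (fun u v : box lam => (u.1 < v.1) && (u.2 < v.2))%N s.

Definition pleasant (S : {set box lam}) : Prop :=
  S \subset diag lam /\
  forall k : int, 1 - (size lam)%:Z <= k <= (head 0%N lam)%:Z - 1 ->
  forall s : seq (box lam),
    desc_chain (S :&: square k) s -> (size s <= #|skew_diagonal k|)%N.

Definition pleasant_diagrams : {set {set box lam}} :=
  [set S : {set box lam} | `[< pleasant S >]].

End Pleasant.

(* Main.v *)
(** To an array A of nonnegative integers on the cells of lam attach
the growth diagram of the Burge variant of RSK: to each lattice point (i, j) a
partition P(i, j), computed from the three partitions at (i-1, j-1), (i-1, j),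
(i, j-1) and the entry A(i-1, j-1) by a reversible local rule.  The size of
P(i, j) is the sum of A over the i x j rectangle, its number of parts is the
length of a longest descending chain of that rectangle in the support of A, and
neighbouring partitions interlace.  Hence the partitions on the southeast
boundary of lam, read from its diagonals, form a reverse plane partition pi of
shape lam; since the local rule is reversible, A |-> pi is a bijection.  The
cell u lies in the rectangle of the diagonal k exactly for h(u) values of k, so
|pi| is the sum of the A(u) h(u).  Finally pi vanishes on mu if and only if, for
every k, at most s_k entries of its k-th diagonal are nonzero, i.e., if and only
if the support of A is pleasant. *)

Require Import Defs.
From mathcomp Require Import all_boot all_order all_algebra.
From mathcomp Require Import boolp zify.

Set Implicit Arguments.
Unset Strict Implicit.
Unset Printing Implicit Defensive.

Import GRing.Theory Num.Theory.

(** * The local rule *)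

Section LocalRule.

Implicit Types (nu l m rho : nat -> nat) (N a r : nat).

(** [l / nu] is a horizontal strip; in particular both sequences are weakly decreasing. *)
Definition interlace nu l := forall r, nu r <= l r /\ l r.+1 <= nu r.

(* [carry nu l m a d r] is the carry c_r entering the part of index r when the
   rule starts with the carry a at the part of index r + d. *)
Fixpoint carry nu l m a d r :=
  if d is d'.+1 then
    (carry nu l m a d' r.+1 - (nu r - maxn (l r.+1) (m r.+1)))
      + (minn (l r) (m r) - nu r)
  else a.

(* N bounds the number of parts of l and m, and rho_0 is not capped: the missing
   part nu_(-1) is infinite. *)
Definition local_rule N nu l m a r :=
  let x := maxn (l r) (m r) + carry nu l m a (N - r) r in
  if r is r'.+1 then minn x (nu r') else x.

(** The carries are read back off [rho] from the largest part downwards, in the order opposite to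
    [carry]. Below its cap a part shows its carry directly; at the cap the surplus is found in the
    carry of the next larger part. *)
Fixpoint inv_carry l m rho r :=
  if r is r'.+1 then
    (rho r - maxn (l r) (m r)) + (inv_carry l m rho r' - (minn (l r') (m r') - rho r))
  else rho 0 - maxn (l 0) (m 0).

(** If the cap [nu r] was reached, it equals [rho r.+1]; otherwise the carry at [r] is exactly
    [minn (l r) (m r) - nu r]. The maximum selects the right value in both cases. *)
Definition inv_rule l m rho r :=
  maxn (rho r.+1) (minn (l r) (m r) - inv_carry l m rho r).

Lemma carryE N nu l m a r : r < N ->
  carry nu l m a (N - r) r =
    (carry nu l m a (N - r.+1) r.+1 - (nu r - maxn (l r.+1) (m r.+1)))
      + (minn (l r) (m r) - nu r).
Proof. by move=> lt_rN; rewrite subnS -[in LHS](prednK (n := N - r)) ?subn_gt0. Qed.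

Lemma local_rule_interlace N nu l m a :
  interlace nu l -> interlace nu m ->
  interlace l (local_rule N nu l m a) /\ interlace m (local_rule N nu l m a).
Proof.
move=> nl nm; split=> -[|r]; rewrite /local_rule.
- by move: (nl 0) (nm 0); lia.
- by move: (nl r) (nm r) (nl r.+1) (nm r.+1); lia.
- by move: (nl 0) (nm 0); lia.
- by move: (nl r) (nm r) (nl r.+1) (nm r.+1); lia.
Qed.

Lemma local_ruleS N nu l m a r : local_rule N nu l m a r.+1 <= nu r.
Proof. by rewrite /local_rule geq_minr. Qed.

Lemma inv_rule_interlace l m rho :
  interlace l rho -> interlace m rho ->
  interlace (inv_rule l m rho) l /\ interlace (inv_rule l m rho) m.
Proof.
move=> lr mr; split=> r; rewrite /inv_rule.
all: by move: (lr r) (mr r) (lr r.+1) (mr r.+1); lia.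
Qed.

Lemma inv_ruleK N l m rho :
  interlace l rho -> interlace m rho ->
  (forall r, N <= r -> l r = 0 /\ m r = 0) -> (forall r, N < r -> rho r = 0) ->
  local_rule N (inv_rule l m rho) l m (inv_carry l m rho N) = rho.
Proof.
move=> lr mr lm0 rho0.
(* Running the rule on the recovered [nu] reproduces the recovered carries, starting at the index
   [N] where the entry is injected and descending to 0. *)
have cE d r : r + d = N ->
    carry (inv_rule l m rho) l m (inv_carry l m rho N) d r = inv_carry l m rho r.
  elim: d r => [|d IHd] r rd /=; first by rewrite -rd addn0.
  rewrite IHd; last by rewrite addSnnS.
  rewrite /= /inv_rule; move: (lr r) (mr r) (lr r.+1) (mr r.+1); lia.
apply/funext => -[|r]; rewrite /local_rule.
  by rewrite cE ?add0n ?subn0 //=; move: (lr 0) (mr 0); lia.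
case: (ltnP r N) => rN.
  rewrite cE ?subnKC //= /inv_rule; move: (lr r) (mr r) (lr r.+1) (mr r.+1); lia.
by rewrite /inv_rule; move: (lm0 r rN) (rho0 r.+1 rN); lia.
Qed.

Lemma local_ruleK N nu l m a :
  interlace nu l -> interlace nu m ->
  (forall r, N <= r -> l r = 0 /\ m r = 0) ->
  inv_rule l m (local_rule N nu l m a) = nu /\
  inv_carry l m (local_rule N nu l m a) N = a.
Proof.
move=> nl nm lm0; set rho := local_rule N nu l m a.
have eE r : r <= N -> inv_carry l m rho r = carry nu l m a (N - r) r.
  elim: r => [|r IHr] rN /=; first by rewrite /rho /local_rule; lia.
  rewrite IHr ?(ltnW rN) // (@carryE N nu l m a r) // /rho /local_rule.
  by move: (nl r) (nm r) (nl r.+1) (nm r.+1); lia.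
split; last by rewrite eE // subnn.
apply/funext => r; rewrite /inv_rule; case: (ltnP r N) => rN.
  rewrite eE ?(ltnW rN) // (@carryE N nu l m a r) // /rho /local_rule.
  by move: (nl r) (nm r) (nl r.+1) (nm r.+1); lia.
rewrite /rho /local_rule.
by move: (nl r) (nm r) (nl r.+1) (nm r.+1) (lm0 r rN); lia.
Qed.

(** Capped or not, each index only redistributes: with c the carries, [rho r.+1 + c_r + nu r] equals
    [maxn (l r.+1) (m r.+1) + c_(r+1) + minn (l r) (m r)]. The carries telescope, and maximum plus
    minimum is [l r + m r]. *)
Lemma local_rule_sum N nu l m a :
  interlace nu l -> interlace nu m ->
  (forall r, N <= r -> l r = 0 /\ m r = 0) ->
  \sum_(r < N.+1) local_rule N nu l m a r + \sum_(r < N) nu r =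
    \sum_(r < N) l r + \sum_(r < N) m r + a.
Proof.
move=> nl nm lm0; set rho := local_rule N nu l m a.
have rho_0 : rho 0 = maxn (l 0) (m 0) + carry nu l m a N 0.
  by rewrite /rho /local_rule subn0.
have rhoS r d : r + d.+1 = N ->
    rho r.+1 = minn (maxn (l r.+1) (m r.+1) + carry nu l m a d r.+1) (nu r).
  by move=> rd; rewrite /rho /local_rule -rd addnS -addSn addKn.
clearbody rho; have step d r : r + d = N ->
    carry nu l m a d r + \sum_(t < d) rho (r + t).+1 + \sum_(t < d) nu (r + t) =
    a + \sum_(t < d) maxn (l (r + t).+1) (m (r + t).+1) +
      \sum_(t < d) minn (l (r + t)) (m (r + t)).
  elim: d r => [|d IHd] r rd; first by rewrite !big_ord0.
  have sumS f : \sum_(t < d.+1) f (r + t) = f r + \sum_(t < d) f (r.+1 + t).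
    by rewrite big_ord_recl addn0; under eq_bigr do rewrite /= /bump add1n -addSnnS.
  rewrite (sumS (fun x => rho x.+1)) (sumS nu) /=.
  rewrite (sumS (fun x => maxn (l x.+1) (m x.+1))) (sumS (fun x => minn (l x) (m x))).
  have /IHd : r.+1 + d = N by rewrite addSnnS.
  have := rhoS r d rd.
  move: (\sum_(t < d) rho _) (\sum_(t < d) nu _) (\sum_(t < d) maxn _ _) => X Y Z.
  by move: (\sum_(t < d) minn _ _) (nl r) (nm r) (nl r.+1) (nm r.+1) => W; lia.
have : carry nu l m a N 0 + \sum_(t < N) rho t.+1 + \sum_(t < N) nu t =
       a + \sum_(t < N) maxn (l t.+1) (m t.+1) + \sum_(t < N) minn (l t) (m t).
  exact: step N 0 (add0n N).
rewrite big_ord_recl /= rho_0.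
have : maxn (l 0) (m 0) + \sum_(t < N) maxn (l t.+1) (m t.+1)
       = \sum_(t < N) maxn (l t) (m t).
  transitivity (\sum_(t < N.+1) maxn (l t) (m t)); first by rewrite big_ord_recl.
  by rewrite big_ord_recr /=; move: (lm0 N (leqnn N)); lia.
have : \sum_(t < N) maxn (l t) (m t) + \sum_(t < N) minn (l t) (m t)
       = \sum_(r < N) l r + \sum_(r < N) m r.
  by rewrite -!big_split /=; apply: eq_bigr => t _; lia.
move: (\sum_(t < N) rho _) (\sum_(t < N) nu _) (\sum_(t < N) l _) (\sum_(t < N) m _).
move: (\sum_(t < N) minn _ _) (\sum_(t < N) maxn (l t) _).
by move: (\sum_(t < N) maxn _ _); lia.
Qed.

(** Past the last part of [l] and [m] the carry is still [a], so the first free index L receives [a]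
    capped by the part L - 1 of [nu] (uncapped if L = 0). A new part thus appears iff [a > 0] and
    [nu] already has L parts. *)
Lemma local_rule_gt0 N nu l m a Lnu Ll Lm :
  interlace nu l -> interlace nu m -> Ll <= N -> Lm <= N ->
  (forall r, (0 < nu r) = (r < Lnu)) -> (forall r, (0 < l r) = (r < Ll)) ->
  (forall r, (0 < m r) = (r < Lm)) ->
  forall r, (0 < local_rule N nu l m a r) =
            (r < maxn (maxn Ll Lm) ((0 < a) * Lnu.+1)).
Proof.
move=> nl nm LlN LmN nuP lP mP r.
have cE d s : maxn Ll Lm <= s -> carry nu l m a d s = a.
  elim: d s => [|d IHd] s Ls //=; rewrite IHd; last by lia.
  by move: (nuP s) (lP s) (mP s) (lP s.+1) (mP s.+1) (nl s); lia.
case: (ltngtP r (maxn Ll Lm)) => rL.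
- have : 0 < maxn (l r) (m r) by move: (lP r) (mP r); lia.
  case: r rL => [|r] rL; rewrite /local_rule; first by lia.
  by move: (nl r) (nm r) (nl r.+1) (nm r.+1); lia.
- case: r rL => [|r] rL; first by lia.
  move: (local_ruleS N nu l m a r) (nuP r) (lP r) (mP r) (nl r) (nm r).
  by case: (0 < a); lia.
- rewrite /local_rule cE; last by rewrite rL.
  move: (lP r) (mP r) (nuP r) (nl r) (nm r).
  case: r rL => [|r] rL; first by case: a {cE}; lia.
  by move: (lP r) (mP r) (nuP r) (nl r) (nm r); case: a {cE}; lia.
Qed.

End LocalRule.

(** * Growth diagrams *)

Section Growth.

Implicit Types (A : nat -> nat -> nat) (i j r : nat).

(* [growth A i j] is the partition attached to the rectangle of the cells (a, b)
   with a < i and b < j. *)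
Fixpoint growth A i : nat -> nat -> nat :=
  if i is i'.+1 then
    fix row j := if j is j'.+1 then
      local_rule i'.+1 (growth A i' j') (growth A i' j'.+1) (row j') (A i' j')
    else fun=> 0
  else fun _ _ => 0.

(** Length of a longest descending chain of positive entries in the rectangle: it avoids the last
    row, or avoids the last column, or ends at the corner cell. *)
Fixpoint chain_len A i : nat -> nat :=
  if i is i'.+1 then
    fix row j := if j is j'.+1 then
      maxn (maxn (chain_len A i' j'.+1) (row j')) ((0 < A i' j') * (chain_len A i' j').+1)
    else 0
  else fun=> 0.

Lemma growthi0 A i r : growth A i 0 r = 0.
Proof. by case: i. Qed.

Lemma growthS A i j : growth A i.+1 j.+1 =
  local_rule i.+1 (growth A i j) (growth A i j.+1) (growth A i.+1 j) (A i j).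
Proof. by []. Qed.

Lemma chain_lenS A i j : chain_len A i.+1 j.+1 =
  maxn (maxn (chain_len A i j.+1) (chain_len A i.+1 j)) ((0 < A i j) * (chain_len A i j).+1).
Proof. by []. Qed.

(** By [local_ruleS] one diagonal step southeast adds at most one part. *)
Lemma growth_eq0 A i j r : minn i j <= r -> growth A i j r = 0.
Proof.
elim: i j r => [|i IHi] [|j] [|r] //; rewrite minnSS // ltnS => /IHi nu0.
by apply/eqP; rewrite -leqn0 -nu0 growthS local_ruleS.
Qed.

Lemma growth_interlace A i j :
  interlace (growth A i j) (growth A i.+1 j) /\
  interlace (growth A i j) (growth A i j.+1).
Proof.
(* Interlacing along row [k] propagates to row [k.+1], cell by cell from the axis. *)
have step k : (forall l, interlace (growth A k l) (growth A k l.+1)) ->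
    forall l, interlace (growth A k l) (growth A k.+1 l) /\
              interlace (growth A k.+1 l) (growth A k.+1 l.+1).
  move=> H; elim=> [|l [IHv IHh]].
    have V : interlace (growth A k 0) (growth A k.+1 0).
      by move=> r; rewrite !growthi0.
    by have [] := local_rule_interlace k.+1 (A k 0) (H 0) V.
  have [V _] := local_rule_interlace k.+1 (A k l) (H l) IHv.
  by have [] := local_rule_interlace k.+1 (A k l.+1) (H l.+1) V.
have H k : forall l, interlace (growth A k l) (growth A k l.+1).
  elim: k => [l r|k IHk l] //; by have [] := step k IHk l.
by split=> //; have [] := step i (H i) j.
Qed.

Lemma growth_args0 A i j r : i.+1 <= r ->
  growth A i j.+1 r = 0 /\ growth A i.+1 j r = 0.
Proof. by move=> ir; rewrite !growth_eq0 //; lia. Qed.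

(** [local_rule_sum] is the inclusion-exclusion satisfied by sums over rectangles. *)
Lemma growth_sum A i j :
  \sum_(r < i) growth A i j r = \sum_(a < i) \sum_(b < j) A a b.
Proof.
elim: i j => [|i IHi] j; first by rewrite !big_ord0.
elim: j => [|j IHj].
  by rewrite big1 => [|r _]; rewrite ?growthi0 // big1 // => a _; rewrite big_ord0.
have [V H] := growth_interlace A i j.
have := local_rule_sum (A i j) H V (@growth_args0 A i j).
rewrite -growthS {}IHj big_ord_recr /= -growthS growth_eq0 ?addn0; last by lia.
rewrite [\sum_(r < i.+1) growth A i j r]big_ord_recr growth_eq0 ?geq_minl //= IHi addn0.
rewrite [\sum_(r < i.+1) growth A i j.+1 r]big_ord_recr growth_eq0 ?geq_minl //= IHi addn0.
under [\sum_(a < i) \sum_(b < j.+1) _]eq_bigr do rewrite big_ord_recr.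
under [\sum_(a < i.+1) \sum_(b < j.+1) _]eq_bigr do rewrite big_ord_recr.
by rewrite !big_split !(@big_ord_recr _ _ _ i) /=; lia.
Qed.

Lemma growth_gt0 A i j r : (0 < growth A i j r) = (r < chain_len A i j).
Proof.
elim: i j r => [|i IHi] j r //; elim: j r => [|j IHj] r //=.
have [V H] := growth_interlace A i j.
have lenP k l s : (forall r, (0 < growth A k l r) = (r < chain_len A k l)) ->
    minn k l <= s -> chain_len A k l <= s.
  by move=> h /(growth_eq0 A) g0; rewrite leqNgt -h g0.
rewrite -(local_rule_gt0 (N := i.+1) (A i j) H V _ _ (IHi j) (IHi j.+1) IHj) //.
  by apply: lenP => //; lia.
by apply: lenP => //; lia.
Qed.

End Growth.

(** * Recovering the array from the boundary partitions *)

Section Corners.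

Variables (D : nat -> nat -> bool) (B : nat).
Hypothesis Dle : forall i j i' j', i <= i' -> j <= j' -> D i' j' -> D i j.
Hypothesis Dbound : forall i j, D i j -> i + j < B.

(* The lattice points, i.e., corners of cells, of the closed region covered by D
   (extended by the two axes). Those which are not the northwest corner of a cell
   of D form its southeast boundary. *)
Definition reg i j := if (i, j) is (i'.+1, j'.+1) then D i' j' else true.

(** Induction from the southeast boundary towards the origin; it is well founded because [i + j] is
    bounded on [D]. *)
Lemma downward_ind (P : nat -> nat -> Prop) :
  (forall i j, ~~ D i j -> P i j) ->
  (forall i j, D i j -> P i.+1 j -> P i j.+1 -> P i.+1 j.+1 -> P i j) ->
  forall i j, P i j.
Proof.
move=> Pout Pin i j; have [n] := ubnP (B - (i + j)).
elim: n i j => // n IHn i j ltn; case: (boolP (D i j)) => Dij; last exact: Pout.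
by have ltB := Dbound Dij; apply: Pin => //; apply: IHn; lia.
Qed.

Lemma reg_le i j i' j' : i <= i' -> j <= j' -> reg i' j' -> reg i j.
Proof. by case: i i' j j' => [|i] [|i'] [|j] [|j'] //=; rewrite !ltnS; apply: Dle. Qed.

(** At each cell the inverse rule computes the northwest partition and the entry from the other
    three partitions, so agreement on the boundary spreads inwards. *)
Lemma growth_inj A A' :
  (forall i j, ~~ D i j -> A i j = 0) -> (forall i j, ~~ D i j -> A' i j = 0) ->
  (forall i j, reg i j -> ~~ D i j -> growth A i j = growth A' i j) ->
  forall i j, A i j = A' i j.
Proof.
move=> A0 A'0 eqb.
have eqA i j : D i j -> growth A i.+1 j = growth A' i.+1 j ->
    growth A i j.+1 = growth A' i j.+1 -> growth A i.+1 j.+1 = growth A' i.+1 j.+1 ->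
    growth A i j = growth A' i j /\ A i j = A' i j.
  move=> Dij eqm eql; rewrite !growthS => eqr.
  have [V H] := growth_interlace A i j.
  have [V' H'] := growth_interlace A' i j.
  have [] := local_ruleK (A i j) H V (@growth_args0 A i j).
  have [] := local_ruleK (A' i j) H' V' (@growth_args0 A' i j).
  by rewrite eqr eqm eql => -> -> <- <-.
have eqg : forall i j, reg i j -> growth A i j = growth A' i j.
  apply: downward_ind => [i j nD Rij|i j Dij IHm IHl IHr _]; first exact: eqb.
  have Rij : reg i.+1 j.+1 by [].
  have [] := eqA _ _ Dij; [apply: IHm|apply: IHl|apply: IHr|by []] => //.
    by apply: reg_le Rij.
  by apply: reg_le Rij.
move=> i j; case: (boolP (D i j)) => Dij; last by rewrite A0 ?A'0.
have Rij : reg i.+1 j.+1 by [].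
by have [] := eqA _ _ Dij; rewrite ?eqg //; apply: reg_le Rij.
Qed.

(* The diagonal of pi ending at the cell (i-1, j-1), read backwards. *)
Definition diag_parts (pi : nat -> nat -> nat) i j r :=
  if (r < i) && (r < j) then pi (i - r.+1) (j - r.+1) else 0.

Section Inverse.

Variable pi : nat -> nat -> nat.
Hypothesis pi_mono : forall i j i' j',
  i <= i' -> j <= j' -> D i' j' -> pi i j <= pi i' j'.

(** The growth diagram computed backwards: diagonals of [pi] off [D], the inverse rule inside. [n]
    is fuel, and [B] units suffice by [Dbound]. *)
Fixpoint shrink n i j : nat -> nat :=
  if n is n'.+1 then
    if D i j then inv_rule (shrink n' i j.+1) (shrink n' i.+1 j) (shrink n' i.+1 j.+1)
    else diag_parts pi i j
  else diag_parts pi i j.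

Lemma shrink_stable n n' i j : B <= i + j + n -> B <= i + j + n' ->
  shrink n i j = shrink n' i j.
Proof.
elim: n n' i j => [|n IHn] [|n'] i j Bn Bn' //=.
- by case: ifP => // /Dbound; lia.
- by case: ifP => // /Dbound; lia.
- case: ifP => // Dij; congr (inv_rule _ _ _); apply: IHn; lia.
Qed.

Let R i j := shrink B i j.

Lemma shrink_out i j : ~~ D i j -> R i j = diag_parts pi i j.
Proof. by rewrite /R; case: (B) => //= n /negbTE ->. Qed.

Lemma shrink_in i j : D i j -> R i j = inv_rule (R i j.+1) (R i.+1 j) (R i.+1 j.+1).
Proof.
move=> Dij; rewrite /R (@shrink_stable B B.+1) /= ?Dij //; lia.
Qed.

(** Interlacing of neighbouring diagonals is the monotonicity of [pi] along rows and columns; [reg]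
    keeps the larger cell inside [D], where [pi_mono] applies. *)
Lemma diag_parts_interlace i j :
  (reg i.+1 j -> interlace (diag_parts pi i j) (diag_parts pi i.+1 j)) /\
  (reg i j.+1 -> interlace (diag_parts pi i j) (diag_parts pi i j.+1)).
Proof.
split=> Rij r; rewrite /diag_parts; split.
- case: ifP => // /andP[ri rj]; rewrite ifT; last by lia.
  apply: pi_mono; [lia..|]; move: Rij; case: j rj => // j rj /=.
  by apply: Dle; lia.
- case: ifP => // /andP[ri rj]; rewrite ifT; last by lia.
  apply: pi_mono; [lia..|]; move: Rij; case: j rj => // j rj /=.
  by apply: Dle; lia.
- case: ifP => // /andP[ri rj]; rewrite ifT; last by lia.
  apply: pi_mono; [lia..|]; move: Rij; case: i ri => // i ri /=.
  by apply: Dle; lia.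
- case: ifP => // /andP[ri rj]; rewrite ifT; last by lia.
  apply: pi_mono; [lia..|]; move: Rij; case: i ri => // i ri /=.
  by apply: Dle; lia.
Qed.

Lemma shrink_interlace : forall i j,
  (reg i.+1 j -> interlace (R i j) (R i.+1 j)) /\
  (reg i j.+1 -> interlace (R i j) (R i j.+1)).
Proof.
apply: downward_ind => [i j nD|i j Dij [_ IHm] [IHl _] _].
  have nD1 : ~~ D i.+1 j by apply: contra nD; apply: Dle.
  have nD2 : ~~ D i j.+1 by apply: contra nD; apply: Dle.
  by rewrite !shrink_out //; exact: diag_parts_interlace.
rewrite (shrink_in Dij).
by have [] := inv_rule_interlace (IHl Dij) (IHm Dij).
Qed.

Lemma shrink_eq0 : forall i j r, minn i j <= r -> R i j r = 0.
Proof.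
apply: downward_ind => [i j nD r mr|i j Dij IHm IHl IHr r mr].
  by rewrite shrink_out // /diag_parts; case: ifP => //; lia.
rewrite (shrink_in Dij) /inv_rule IHr ?minnSS //.
by case: (leqP i r) => ir; [rewrite IHl|rewrite IHm]; lia.
Qed.

Lemma growth_surj : exists A, (forall i j, ~~ D i j -> A i j = 0) /\
  (forall i j, reg i j -> ~~ D i j -> growth A i j = diag_parts pi i j).
Proof.
(* The entry is the carry recovered at index [i.+1], where [local_rule i.+1] injects it. *)
pose A i j := if D i j then
  inv_carry (R i j.+1) (R i.+1 j) (R i.+1 j.+1) i.+1 else 0.
exists A; split=> [i j nD|]; first by rewrite /A (negbTE nD).
suff gR i j : reg i j -> growth A i j = R i j.
  by move=> i j Rij nD; rewrite gR // shrink_out.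
have R0 i' j' : minn i' j' = 0 -> R i' j' = fun=> 0.
  by move=> m0; apply/funext => r; rewrite shrink_eq0 // m0.
elim: i j => [|i IHi] j; first by rewrite R0 ?min0n.
elim: j => [|j IHj Rij]; first by rewrite R0 ?minn0.
rewrite growthS IHi ?IHj ?IHi ?(reg_le _ _ Rij) //.
have [_ H] := shrink_interlace i.+1 j.
have [V _] := shrink_interlace i j.+1.
rewrite /A (Rij : D i j) (shrink_in Rij).
apply: inv_ruleK; [exact: V|exact: H|move=> r ir|move=> r ir].
  by rewrite !shrink_eq0 //; lia.
by rewrite shrink_eq0 //; lia.
Qed.

End Inverse.

End Corners.

(** * Diagonals of the diagram of lam *)

Lemma content_range (lam : seq nat) (u : box lam) : (- Posz (size lam) <= content u)%R.
Proof. by have := ltn_ord u.1; rewrite /content; lia. Qed.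

Section Diagram.

Variable lam : seq nat.
Hypothesis lam_part : is_partition lam.

Let sorted_lam : sorted geq lam. Proof. by case/andP: lam_part. Qed.

Lemma nth_part_le i i' : i <= i' -> nth 0 lam i' <= nth 0 lam i.
Proof.
move=> ii'; case: (ltnP i' (size lam)) => i'M; last by rewrite (nth_default _ i'M).
apply: (@sorted_leq_nth _ geq) => //.
- by move=> a b c; rewrite /= => ba ac; apply: leq_trans ac ba.
- by move=> a /=.
- by rewrite inE; apply: leq_ltn_trans i'M.
Qed.

Lemma in_diag_le i j i' j' :
  i <= i' -> j <= j' -> in_diag lam i' j' -> in_diag lam i j.
Proof.
rewrite /in_diag => /nth_part_le ii' jj' j'i'.
by apply: leq_ltn_trans jj' (leq_trans j'i' ii').
Qed.

Lemma in_diag_box i j : in_diag lam i j -> i < size lam /\ j < head 0 lam.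
Proof.
rewrite /in_diag => ji; split; last by rewrite -nth0; apply: leq_trans ji (nth_part_le _).
by rewrite ltnNge; apply/negP => Mi; move: ji; rewrite nth_default.
Qed.

(** In a weakly decreasing list the parts greater than [j] form an initial segment. *)
Lemma in_diag_conj i j : in_diag lam i j = (i < conj_part lam j).
Proof.
rewrite /in_diag /conj_part; elim: lam sorted_lam i => [|x s IHs] /= xs i.
  by rewrite nth_nil.
have /IHs {}IHs := path_sorted xs.
case: (ltnP j x) => jx; first by case: i => [|i] //=; rewrite add1n ltnS IHs.
have s0 : count (fun y => j < y) s = 0.
  apply/eqP; rewrite -leqn0 leqNgt -has_count; apply/negP => /hasP[y ys jy].
  have /allP /(_ y ys) /= yx := order_path_min (fun a b c ba ac => leq_trans ac ba) xs.
  by move: jy; rewrite ltnNge (leq_trans yx jx).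
by rewrite s0; case: i => [|i]; rewrite /= ?IHs ?s0 // ltnNge jx.
Qed.

Definition rows k := square_rows lam k.
Definition cols k := absz (Posz (rows k) + k)%R.

Notation reg := (reg (in_diag lam)).
(** Wider than the set of contents of [lam]: at the lower end the rectangle has no columns, and from
    the largest part on it has no rows. *)
Notation in_range k := (- Posz (size lam) <= k)%R.

Lemma rect_fitsP a b :
  reflect (forall i j, i < a -> j < b -> in_diag lam i j) (rect_fits lam a b).
Proof.
apply: (iffP forallP) => [H i j ia jb|H i].
  by move/forallP: (H (Ordinal ia)) => /(_ (Ordinal jb)).
by apply/forallP => j; apply: H.
Qed.

Lemma rect_fits_reg a b : rect_fits lam a b = reg a b.
Proof.
apply/rect_fitsP/idP => [H|]; first by case: a b H => [|a] [|b] //= H; apply: H.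
case: a b => [|a] [|b] //= Dab i j ia jb; by apply: in_diag_le Dab.
Qed.

(** By maximality, the southeast corner of the rectangle is the point where the diagonal [k] meets
    the boundary. *)
Lemma square_cornerP (k : int) : in_range k ->
  [/\ rows k <= size lam, Posz (cols k) = (Posz (rows k) + k)%R,
      reg (rows k) (cols k) & ~~ in_diag lam (rows k) (cols k)].
Proof.
move=> kM; pose P (i : 'I_(size lam).+1) :=
  ((0 <= Posz i + k)%R && rect_fits lam i (absz (Posz i + k)%R)).
have Pgt0 : 0 < #|P|.
  (* The witness is an empty rectangle, where the diagonal meets an axis: [-k] rows and no columns,
     or no rows if [k > 0]. *)
  have lt : absz (if (k <= 0)%R then k else 0%R) < (size lam).+1 by case: ifP; lia.
  apply/card_gt0P; exists (Ordinal lt); rewrite unfold_in /P rect_fits_reg /=.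
  apply/andP; split; first by case: ifP; lia.
  case: ifP => [k0|//]; have -> : absz (Posz `|k| + k)%R = 0 by lia.
  by case: (absz _).
have [i /andP[i0 fit] Ei] := eq_bigmax_cond (fun i : 'I_(size lam).+1 => i : nat) Pgt0.
have Er : rows k = i by rewrite /rows /square_rows -Ei; apply: eq_bigl.
have Ec : Posz (cols k) = (Posz (rows k) + k)%R by rewrite /cols Er; lia.
split=> //; first by rewrite Er -ltnS.
  by rewrite -rect_fits_reg /cols Er.
(* Otherwise the rectangle could be enlarged by one row and one column. *)
apply/negP => Drc; have [rM _] := in_diag_box Drc.
have lt : (rows k).+1 < (size lam).+1 by [].
suff : (rows k).+1 <= rows k by rewrite ltnn.
have Ec1 : absz (Posz (rows k).+1 + k)%R = (cols k).+1 by lia.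
apply: (leq_bigmax_cond (Ordinal lt)); rewrite rect_fits_reg.
apply/andP; split; last by rewrite [absz _]Ec1.
by have : nat_of_ord (Ordinal lt) = (rows k).+1 by []; lia.
Qed.

Lemma in_square_diag (k : int) a b : in_range k -> (Posz b - Posz a = k)%R ->
  in_diag lam a b = (a < rows k) && (b < cols k).
Proof.
move=> kM E; have [_ Ec Rr Dr] := square_cornerP kM.
apply/idP/andP => [Dab|[ar bc]].
  by case: (ltnP a (rows k)) => ar; [lia|move: Dr; rewrite (in_diag_le _ _ Dab) //; lia].
by case: (rows k) (cols k) Rr ar bc => [|r] [|c] //= Drc ar bc; apply: in_diag_le Drc.
Qed.

(** The admissible [k] run from the content of the foot of the column to that of the end of the row:
    they are the contents of the cells of the hook, one for each cell. *)
Lemma in_square_hook (k : int) a b : in_range k -> in_diag lam a b ->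
  ((a < rows k) && (b < cols k)) =
  (Posz b - Posz (conj_part lam b) < k)%R && (k < Posz (nth 0%N lam a) - Posz a)%R.
Proof.
move=> kM Dab; have [_ Ec Rr Dr] := square_cornerP kM.
apply/andP/andP => -[].
  case: (rows k) (cols k) Rr Ec Dr => [|r] [|c] //= Drc Ec _ ar bc.
  have : in_diag lam a c by apply: in_diag_le Drc.
  have : in_diag lam r b by apply: in_diag_le Drc.
  by rewrite in_diag_conj /in_diag; lia.
move=> lk kl; split; rewrite ltnNge; apply/negP => le; move/negP: Dr; apply.
  by apply: (@in_diag_le _ _ a (cols k)) => //; rewrite /in_diag; lia.
by apply: (@in_diag_le _ _ (rows k) b) => //; rewrite in_diag_conj; lia.
Qed.

(** Ensures that the rectangles reach every boundary point off the axes, so that [growth_rpp]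
    records all boundary partitions. *)
Lemma corner_uniq i j : i <= size lam -> reg i.+1 j.+1 -> ~~ in_diag lam i.+1 j.+1 ->
  rows (Posz j - Posz i)%R = i.+1 /\ cols (Posz j - Posz i)%R = j.+1.
Proof.
move=> iM Dij nD; set k := (_ - _)%R; have kM : in_range k by rewrite /k; lia.
have [_ Ec Rr Dr] := square_cornerP kM.
have : in_diag lam i j by [].
rewrite (in_square_diag kM erefl) => /andP[ir jc].
have [ri|] := leqP (rows k) i.+1; first by lia.
move=> ri; case: (rows k) (cols k) ri Ec Rr => [|r] [|c] //= ri Ec Rr; try lia.
by move/negP: nD; case; apply: in_diag_le Rr; lia.
Qed.

(** Inverse of [diag_parts]: the southeasternmost cell of a diagonal holds the part of index 0, and
    the parts decrease towards the northwest. *)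
Definition growth_rpp A a b :=
  let k := (Posz b - Posz a)%R in growth A (rows k) (cols k) (rows k - a.+1).

(** The corners of two consecutive diagonals differ by one unit step of the boundary, horizontal or
    vertical, so their partitions interlace. *)
Lemma growth_rpp_stepr A a b :
  in_diag lam a b.+1 -> growth_rpp A a b <= growth_rpp A a b.+1.
Proof.
move=> Dab; have [aM _] := in_diag_box Dab; rewrite /growth_rpp.
set k := (Posz b - _)%R; set k' := (_ - _)%R.
have kM : in_range k by lia.
have kM' : in_range k' by lia.
have [_ Ec Rr Dr] := square_cornerP kM.
have [_ Ec' Rr' Dr'] := square_cornerP kM'.
move: (Dab); rewrite (in_square_diag kM' erefl) => /andP[ar bc].
have le1 : rows k' <= rows k.
  rewrite leqNgt; apply/negP => lt; move/negP: Dr; apply.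
  case: (rows k') (cols k') lt Rr' Ec' => [|r] [|c] //= lt Rr' Ec'; first by lia.
  by apply: in_diag_le Rr'; lia.
have le2 : rows k <= (rows k').+1.
  rewrite leqNgt; apply/negP => lt; move/negP: Dr'; apply.
  case: (rows k) (cols k) lt Rr Ec => [|r] [|c] //= lt Rr Ec; try by lia.
  by apply: in_diag_le Rr; lia.
have [E|lt] := eqVneq (rows k) (rows k').
  have -> : cols k' = (cols k).+1 by lia.
  by rewrite E; have [_ /(_ (rows k' - a.+1))[]] := growth_interlace A (rows k') (cols k).
have Er : rows k = (rows k').+1 by lia.
have -> : cols k = cols k' by lia.
rewrite Er; have -> : (rows k').+1 - a.+1 = (rows k' - a.+1).+1 by lia.
by have [/(_ (rows k' - a.+1))[]] := growth_interlace A (rows k') (cols k').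
Qed.

Lemma growth_rpp_stepd A a b :
  in_diag lam a.+1 b -> growth_rpp A a b <= growth_rpp A a.+1 b.
Proof.
move=> Dab; have [aM _] := in_diag_box Dab; rewrite /growth_rpp.
set k := (_ - Posz a)%R; set k' := (_ - _)%R.
have kM : in_range k by lia.
have kM' : in_range k' by lia.
have [_ Ec Rr Dr] := square_cornerP kM.
have [_ Ec' Rr' Dr'] := square_cornerP kM'.
move: (Dab); rewrite (in_square_diag kM' erefl) => /andP[ar bc].
have le1 : rows k <= rows k'.
  rewrite leqNgt; apply/negP => lt; move/negP: Dr'; apply.
  case: (rows k) (cols k) lt Rr Ec => [|r] [|c] //= lt Rr Ec; try by lia.
  by apply: in_diag_le Rr; lia.
have le2 : rows k' <= (rows k).+1.
  rewrite leqNgt; apply/negP => lt; move/negP: Dr; apply.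
  case: (rows k') (cols k') lt Rr' Ec' => [|r] [|c] //= lt Rr' Ec'; try by lia.
  by apply: in_diag_le Rr'; lia.
have [E|lt] := eqVneq (rows k) (rows k').
  have Ecc : cols k = (cols k').+1 by lia.
  rewrite Ecc E; have -> : rows k' - a.+1 = (rows k' - a.+2).+1 by lia.
  by have [_ /(_ (rows k' - a.+2))[]] := growth_interlace A (rows k') (cols k').
have Er : rows k' = (rows k).+1 by lia.
have -> : cols k' = cols k by lia.
rewrite Er subSS.
by have [/(_ (rows k - a.+1))[]] := growth_interlace A (rows k) (cols k).
Qed.

Lemma growth_rpp_le A a b a' b' : a <= a' -> b <= b' -> in_diag lam a' b' ->
  growth_rpp A a b <= growth_rpp A a' b'.
Proof.
move=> aa' bb' Dab'; apply: (@leq_trans (growth_rpp A a b')).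
  have : in_diag lam a b' by apply: in_diag_le Dab'.
  elim: b' bb' {Dab'} => [|b' IHb]; first by rewrite leqn0 => /eqP ->.
  rewrite leq_eqVlt => /orP[/eqP -> //|bb' Dab].
  apply: leq_trans (growth_rpp_stepr A Dab); apply: IHb => //.
  by apply: in_diag_le Dab.
elim: a' aa' Dab' => [|a' IHa]; first by rewrite leqn0 => /eqP ->.
rewrite leq_eqVlt => /orP[/eqP -> //|aa' Dab].
apply: leq_trans (growth_rpp_stepd A Dab); apply: IHa => //.
by apply: in_diag_le Dab.
Qed.

Lemma sum_diagonal (k : int) (F : nat -> nat -> nat) : in_range k ->
  \sum_(u in diag lam | content u == k) F u.1 u.2 =
  \sum_(r < rows k | r < cols k) F (rows k - r.+1) (cols k - r.+1).
Proof.
move=> kM; have [rM Ec Rr Dr] := square_cornerP kM.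
transitivity (\sum_(a < size lam) \sum_(b < head 0 lam)
    if ((a, b) \in diag lam) && (content ((a, b) : box lam) == k) then F a b else 0).
  by rewrite big_mkcond pair_bigA; apply: eq_bigr => -[a b].
(* In row [a] the diagonal meets only the column [cols k - (rows k - a)]. *)
transitivity (\sum_(a < size lam | (rows k - a.+1 < cols k) && (a < rows k))
                F a (cols k - (rows k - a))).
  rewrite [RHS]big_mkcond; apply: eq_bigr => a _ /=.
  case: ifPn => [/andP[ac ar]|nac].
    have Da : in_diag lam a (cols k - (rows k - a)).
      by rewrite (in_square_diag kM); lia.
    have [_ bH] := in_diag_box Da.
    rewrite (bigD1 (Ordinal bH)) //= big1 ?addn0 => [|b nb].
      by rewrite ifT // inE /= Da /content /=; apply/eqP; lia.
    rewrite ifN // negb_and; apply/orP; right; apply: contraNneq nb => E.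
    by apply/eqP/val_inj; move: E; rewrite /content /=; lia.
  rewrite big1 // => b _; case: ifP => // /andP[]; rewrite inE /= => Dab /eqP E.
  have {}E : (Posz b - Posz a = k)%R := E.
  by move: Dab; rewrite (in_square_diag kM E); lia.
rewrite -(big_ord_widen_cond _ (fun a => rows k - a.+1 < cols k)
            (fun a => F a (cols k - (rows k - a)))) //.
rewrite (reindex_inj rev_ord_inj) /=; apply: eq_big => r.
  by have := ltn_ord r; lia.
by have := ltn_ord r => ? _; congr (F _ _); lia.
Qed.

Lemma sum_growth_diagonal A (k : int) : in_range k ->
  \sum_(u in diag lam | content u == k) growth_rpp A u.1 u.2 =
  \sum_(a < rows k) \sum_(b < cols k) A a b.
Proof.
move=> kM; have [rM Ec Rr Dr] := square_cornerP kM.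
rewrite sum_diagonal // -growth_sum big_mkcond; apply: eq_bigr => r _ /=.
have := ltn_ord r => ?; case: ifPn => rc; last by rewrite growth_eq0 //; lia.
rewrite /growth_rpp; have -> : (Posz (cols k - r.+1) - Posz (rows k - r.+1) = k)%R by lia.
by congr growth; lia.
Qed.

End Diagram.

(** * Descending chains, hooks and pleasant diagrams *)

Lemma sum_between n lo hi :
  \sum_(d < n) ((lo < d) && (d < hi)) = minn hi n - lo.+1.
Proof. by elim: n => [|n IHn]; rewrite ?big_ord0 ?big_ord_recr /= ?IHn; lia. Qed.

(** The failures of [p] form an initial segment, so their number is the threshold. *)
Lemma up_closed_sumN n (p : nat -> bool) :
  (forall r r', r <= r' -> r' < n -> p r -> p r') ->
  forall r, r < n -> p r = (\sum_(i < n) ~~ p i <= r).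
Proof.
elim: n => // n IHn up r rn; rewrite big_ord_recr /=.
have {}IHn := IHn (fun r r' rr' r'n => up r r' rr' (ltnW r'n)).
have le_n : \sum_(i < n) ~~ p i <= n.
  by rewrite -[leqRHS](card_ord n) -sum1_card leq_sum // => i _; case: (p i).
case: (boolP (p n)) => pn; rewrite ?addn0 ?addn1.
  by move: rn; rewrite ltnS leq_eqVlt => /orP[/eqP ->|/IHn //]; rewrite pn le_n.
have pF k : k <= n -> p k = false.
  by move=> kn; apply/negP => pk; move/negP: pn; apply; apply: up pk.
rewrite pF //; apply/esym/negbTE; rewrite -ltnNge ltnS.
apply: leq_trans (rn : r <= n) _; case: n {up pn rn le_n} IHn pF => // n IHn pF.
by have := IHn n (ltnSn n); rewrite pF // leqNgt => /esym/negbT; rewrite negbK.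
Qed.

Section ChainLength.

Variable lam : seq nat.

Definition se : rel (box lam) := fun u v => (u.1 < v.1) && (u.2 < v.2).

Lemma se_trans : transitive se.
Proof. by move=> v u w /andP[uv1 uv2] /andP[vw1 vw2]; rewrite /se; lia. Qed.

Lemma chain_len_le A i j i' j' :
  i <= i' -> j <= j' -> chain_len A i j <= chain_len A i' j'.
Proof.
have gr k l : chain_len A k l <= chain_len A k l.+1 by case: k => //= k; lia.
have gd k l : chain_len A k l <= chain_len A k.+1 l by case: l => [|l] /=; [case: k|lia].
move=> ii' jj'; apply: (@leq_trans (chain_len A i j')).
  by elim: j' jj' => [|l IHl]; [rewrite leqn0 => /eqP->|
    rewrite leq_eqVlt => /orP[/eqP->//|/IHl] /leq_trans; apply].
by elim: i' ii' => [|k IHk]; [rewrite leqn0 => /eqP->|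
  rewrite leq_eqVlt => /orP[/eqP->//|/IHk] /leq_trans; apply].
Qed.

Definition rect_supp (A : nat -> nat -> nat) i j (u : box lam) :=
  [&& u.1 < i, u.2 < j & 0 < A u.1 u.2].

(** Without its last cell [u], the chain lies in the rectangle strictly northwest of [u]. *)
Lemma size_chain A i j (s : seq (box lam)) :
  sorted se s -> all (rect_supp A i j) s -> size s <= chain_len A i j.
Proof.
rewrite (sorted_pairwise se_trans).
elim/last_ind: s i j => [|s u IHs] i j //.
rewrite pairwise_rcons all_rcons size_rcons => /andP[su ps] /andP[/and3P[ui uj Au] alls].
apply: (@leq_trans (chain_len A u.1.+1 u.2.+1)); last exact: chain_len_le.
rewrite /= Au mul1n leq_max ltnS IHs ?orbT //.
apply/allP => v vs; move/allP: su => /(_ v vs) /andP[v1 v2].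
by move/allP: alls => /(_ v vs) /and3P[_ _ Av]; rewrite /rect_supp v1 v2.
Qed.

Lemma exists_chain A i j :
  (forall a b, 0 < A a b -> a < size lam /\ b < head 0 lam) ->
  exists s : seq (box lam),
    [/\ sorted se s, all (rect_supp A i j) s & size s = chain_len A i j].
Proof.
move=> Abox.
have widen k l k' l' s : k <= k' -> l <= l' ->
    all (rect_supp A k l) s -> all (rect_supp A k' l') s.
  by move=> kk' ll'; apply: sub_all => u /and3P[? ? Au]; apply/and3P; split=> //; lia.
elim: i j => [|i IHi] j; first by exists [::].
elim: j => [|j IHj]; first by exists [::].
have [s1 [S1 R1 L1]] := IHi j.+1.
have [s2 [S2 R2 L2]] := IHj.
have [s3 [S3 R3 L3]] := IHi j.
rewrite chain_lenS; set y := _ * _.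
have [le1|] := leqP y (maxn (chain_len A i j.+1) (chain_len A i.+1 j)).
  have [le2|le2] := leqP (chain_len A i j.+1) (chain_len A i.+1 j).
    by exists s2; split=> //; exact: widen R2.
  by exists s1; split=> //; exact: widen R1.
rewrite /y => lt; have Aij : 0 < A i j by move: lt; case: (0 < A i j); rewrite ?mul0n ?ltn0.
have [iM jH] := Abox _ _ Aij.
(* The corner cell extends a longest chain of the rectangle strictly northwest of it. *)
exists (rcons s3 (Ordinal iM, Ordinal jH)); split.
- rewrite (sorted_pairwise se_trans) pairwise_rcons -(sorted_pairwise se_trans) S3 andbT.
  by apply: sub_all R3 => u /and3P[u1 u2 _]; rewrite /se u1 u2.
- rewrite all_rcons /rect_supp /= !ltnSn Aij /=.
  exact: widen R3.
- by rewrite size_rcons L3 Aij mul1n.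
Qed.

End ChainLength.

Section Weight.

Variable lam : seq nat.
Hypothesis lam_part : is_partition lam.
Variable A : nat -> nat -> nat.
Hypothesis A0 : forall a b, ~~ in_diag lam a b -> A a b = 0.

Notation rows := (rows lam).
Notation cols := (cols lam).

Lemma sum_square (k : int) : (- Posz (size lam) <= k)%R ->
  \sum_(a < rows k) \sum_(b < cols k) A a b =
  \sum_(u in diag lam) ((u.1 < rows k) && (u.2 < cols k)) * A u.1 u.2.
Proof.
move=> kM; have [rM Ec Rr Dr] := square_cornerP lam_part kM.
transitivity (\sum_(a < size lam) \sum_(b < head 0 lam)
   ((a < rows k) && (b < cols k)) * A a b); last first.
  rewrite pair_bigA /= [RHS]big_mkcond; apply: eq_bigr => u _; rewrite inE.
  by case: ifPn => // /A0 ->; rewrite muln0.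
rewrite (big_ord_widen _ (fun a => \sum_(b < cols k) A a b) rM) big_mkcond.
apply: eq_bigr => a _; case: ifPn => ar; last by rewrite big1.
have cH : cols k <= head 0 lam.
  case: (rows k) (cols k) Rr ar => [|r] [|c] // Drc _.
  by have [] := in_diag_box lam_part (Drc : in_diag lam r c).
rewrite (big_ord_widen _ (fun b => A a b) cH) big_mkcond.
by apply: eq_bigr => b _ /=; case: ifP; rewrite ?mul1n.
Qed.

(** Each diagonal sums to the total of [A] over its rectangle. Exchanging the sums counts the
    rectangles containing a given cell, which [in_square_hook] identifies with its hook-length. *)
Lemma growth_rpp_weight :
  \sum_(u in diag lam) growth_rpp lam A u.1 u.2 = \sum_(u in diag lam) A u.1 u.2 * hook u.
Proof.
(* Contents are shifted by [size lam] to become natural numbers. *)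
have lt_d (u : box lam) : u.2 + size lam - u.1 < size lam + head 0 lam.
  by have := ltn_ord u.2; lia.
rewrite (partition_big (fun u => Ordinal (lt_d u)) xpredT) //=.
transitivity (\sum_(d < size lam + head 0 lam) \sum_(u in diag lam)
    ((u.1 < rows (Posz d - Posz (size lam))) &&
     (u.2 < cols (Posz d - Posz (size lam)))) * A u.1 u.2).
  apply: eq_bigr => d _; set k : int := (_ - _)%R.
  have kM : (- Posz (size lam) <= k)%R by rewrite /k; lia.
  rewrite -(sum_square kM) -(sum_growth_diagonal lam_part) //; apply: eq_bigl => u.
  congr (_ && _); apply/eqP/eqP => [/(congr1 val) /= E|].
    by rewrite /k /content; have := ltn_ord u.1; lia.
  by rewrite /k /content => E; apply/val_inj => /=; have := ltn_ord u.1; lia.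
rewrite exchange_big /=; apply: eq_bigr => u; rewrite inE => Du.
rewrite -big_distrl mulnC /=; congr (_ * _).
have [u1 u2] := in_diag_box lam_part Du; move: (Du) (Du).
rewrite {1}in_diag_conj // /in_diag => ltc ltl.
have cM : conj_part lam u.2 <= size lam by apply: count_size.
have lH : nth 0 lam u.1 <= head 0 lam.
  by rewrite -[head 0 lam in leqRHS]nth0; apply: nth_part_le.
transitivity (\sum_(d < size lam + head 0 lam)
    ((size lam + u.2 - conj_part lam u.2 < d) && (d < size lam + nth 0 lam u.1 - u.1))).
  apply: eq_bigr => d _; congr nat_of_bool.
  rewrite in_square_hook //; last by lia.
  by congr (_ && _); lia.
by rewrite sum_between /hook; lia.
Qed.

End Weight.

Section PleasantSupport.

Variables lam mu : seq nat.
Hypothesis lam_part : is_partition lam.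
Hypothesis mu_part : is_partition mu.
Variable A : nat -> nat -> nat.
Hypothesis A0 : forall a b, ~~ in_diag lam a b -> A a b = 0.

Notation rows := (rows lam).
Notation cols := (cols lam).

(** Counted from the southeast, the cells of the diagonal outside [mu] come first, so those in [mu]
    have index at least s_k; the nonzero parts are those of index below [chain_len]. *)
Lemma chain_len_le_skew_diagonal (k : int) : (- Posz (size lam) <= k)%R ->
  chain_len A (rows k) (cols k) <= #|skew_diagonal lam mu k| <->
  forall u : box lam, u \in diag lam -> content u = k -> in_diag mu u.1 u.2 ->
    growth_rpp lam A u.1 u.2 = 0.
Proof.
move=> kM; have [rM Ec Rr Dr] := square_cornerP lam_part kM.
(* [r] counts cells from the southeast end; once the columns have run out [p] is set to true, which
   keeps it upward closed. *)
pose p r := (cols k <= r) || in_diag mu (rows k - r.+1) (cols k - r.+1).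
have cardE : #|skew_diagonal lam mu k| = \sum_(r < rows k) ~~ p r.
  rewrite -sum1_card big_mkcond.
  transitivity (\sum_(u in diag lam | content u == k) ~~ in_diag mu u.1 u.2).
    rewrite [RHS]big_mkcond; apply: eq_bigr => u _; rewrite !inE.
    by case: (in_diag lam _ _); case: (in_diag mu _ _); case: (_ == k).
  rewrite (sum_diagonal lam_part (fun a b => ~~ in_diag mu a b) kM) big_mkcond.
  by apply: eq_bigr => r _; rewrite /p ltnNge; case: (_ <= _).
have pE := @up_closed_sumN (rows k) p; rewrite -cardE in pE.
have {}pE : forall r, r < rows k -> p r = (#|skew_diagonal lam mu k| <= r).
  apply: pE => r r' rr' r'n /orP[cr|Dmu]; rewrite /p; first by rewrite (leq_trans cr).
  by apply/orP; right; apply: in_diag_le Dmu; lia.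
split=> [Ls u Du Eu Dmu|H].
  move: Du; rewrite inE (in_square_diag lam_part kM Eu) => /andP[ur uc].
  have Eu' : (Posz u.2 - Posz u.1 = k)%R := Eu.
  rewrite /growth_rpp Eu'; apply/eqP; rewrite -leqn0 leqNgt growth_gt0 -leqNgt.
  apply: leq_trans Ls _; rewrite -pE; last by lia.
  rewrite /p; apply/orP; right; move: Dmu; congr in_diag; lia.
(* A longer chain would make the part of index s_k nonzero, although its cell lies in [mu]. *)
rewrite leqNgt; apply/negP => lt; have := lt; rewrite -growth_gt0.
set s := #|_| in pE lt *.
have sr : s < minn (rows k) (cols k).
  by rewrite ltnNge; apply/negP => /(growth_eq0 A); move: lt; rewrite -growth_gt0; lia.
have : p s by rewrite pE //; lia.
rewrite /p leqNgt; case/orP => [|Dmu]; first by lia.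
have Ek : (Posz (cols k - s.+1) - Posz (rows k - s.+1) = k)%R by lia.
have Dl : in_diag lam (rows k - s.+1) (cols k - s.+1).
  by rewrite (in_square_diag lam_part kM Ek); lia.
have [rM' cH] := in_diag_box lam_part Dl.
have := H (Ordinal rM', Ordinal cH); rewrite inE => /(_ Dl Ek Dmu) /=.
rewrite /growth_rpp Ek; have -> : rows k - (rows k - s.+1).+1 = s by lia.
by move=> ->.
Qed.

(** [S] meets each rectangle in the support of [A] there, so its longest descending chain has length
    [chain_len]. *)
Lemma pleasant_supportP (S : {set box lam}) : (forall u, (u \in S) = (0 < A u.1 u.2)) ->
  pleasant mu S <->
  forall u, u \in diag lam -> in_diag mu u.1 u.2 -> growth_rpp lam A u.1 u.2 = 0.
Proof.
move=> SA.
have squareE (k : int) u : (- Posz (size lam) <= k)%R ->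
    (u \in S :&: square lam k) = rect_supp A (rows k) (cols k) u.
  move=> kM; have [_ Ec _ _] := square_cornerP lam_part kM.
  rewrite !inE SA /rect_supp -/(rows k); case: (0 < _); rewrite ?andbT ?andbF //=.
  by congr (_ && _); lia.
have Abox a b : 0 < A a b -> a < size lam /\ b < head 0 lam.
  move=> Aab; apply: in_diag_box => //; apply/negP => /negP /A0; lia.
split=> [[_ H] u Du|H].
  have kM := content_range u.
  suff /(chain_len_le_skew_diagonal kM) H' :
      chain_len A (rows (content u)) (cols (content u)) <=
      #|skew_diagonal lam mu (content u)| by apply: H'.
  have [s [Ss Rs <-]] := exists_chain (rows (content u)) (cols (content u)) Abox.
  apply: H.
    have := ltn_ord u.1; have := ltn_ord u.2; rewrite /content.
    by move: (nat_of_ord u.1) (nat_of_ord u.2) => a b; clear; lia.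
  rewrite /desc_chain Ss andbT; apply/allP => v vs.
  by rewrite -[mem _ _]/(v \in S :&: square lam _) squareE // (allP Rs).
split=> [|k /andP[kM _] s /andP[sT Ss]].
  apply/fintype.subsetP => u; rewrite SA inE.
  by apply: contraLR => /A0 ->.
have {}kM : (- Posz (size lam) <= k)%R by lia.
apply: leq_trans (_ : chain_len A (rows k) (cols k) <= _); last first.
  by apply/chain_len_le_skew_diagonal => // u Du _; apply: H.
apply: size_chain Ss _; apply/allP => v vs.
by rewrite -squareE //; exact: (allP sT).
Qed.

End PleasantSupport.

(** * Expansion of the right-hand side *)

Section PowerSeries.

Variable R : comNzRingType.
Implicit Types f g : fps R.

Lemma fcoef_sum (I : Type) (r : seq I) (P : pred I) (F : I -> fps R) n :
  fcoef (\sum_(i <- r | P i) F i)%R n = (\sum_(i <- r | P i) fcoef (F i) n)%R.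
Proof. exact: (big_morph (fun f => fcoef f n)). Qed.

(** Congruence modulo [q^(n+1)]. *)
Definition eq_upto n f g := forall m, m <= n -> fcoef f m = fcoef g m.

Lemma eq_upto_prod n (I : finType) (F G : I -> fps R) :
  (forall i, eq_upto n (F i) (G i)) -> eq_upto n (\prod_i F i)%R (\prod_i G i)%R.
Proof.
move=> FG; elim/big_ind2: _ => [m _ //|f f' g g' ff' gg' m mn|i _]; last exact: FG.
apply: eq_bigr => i _; rewrite ff' ?gg' //; last by have := ltn_ord i; lia.
by apply: leq_trans mn; rewrite leq_subr.
Qed.

Lemma geometric_series h N : 0 < h ->
  (fpsX ^+ h / (1 - fpsX ^+ h) = \sum_(a < N) fpsX ^+ (h * a.+1) +
     fpsX ^+ (h * N) * (fpsX ^+ h / (1 - fpsX ^+ h)) :> fps R)%R.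
Proof.
move=> h0; set q := (_ / _)%R.
have qE : (q = fpsX ^+ h + fpsX ^+ h * q)%R.
  apply/eqP; rewrite -subr_eq -{1}[q]mul1r -mulrBl mulrC /q.
  by rewrite divrK // unit_1subXn.
elim: N => [|N IHN]; first by rewrite big_ord0 muln0 expr0 mul1r add0r.
rewrite [LHS]IHN big_ord_recr /= -addrA; congr (_ + _)%R.
by rewrite {1}qE mulrDr mulrA -exprD mulnS addnC.
Qed.

Lemma geometric_upto h n : 0 < h ->
  eq_upto n (fpsX ^+ h / (1 - fpsX ^+ h))%R
    (\sum_(a : 'I_n.+1 | a != ord0) fpsX ^+ (h * a))%R.
Proof.
(* The remainder and the last term of the sum both start beyond degree [n]. *)
move=> h0 m mn; rewrite (geometric_series n.+1 h0).
rewrite -[LHS]/(fcoef _ m + fcoef _ m)%R fcoefXnM.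
rewrite ifN ?addr0; last by rewrite -ltnNge mulnS; nia.
rewrite [in LHS]big_ord_recr [in RHS]big_mkcond [in RHS]big_ord_recl /= add0r.
rewrite -[LHS]/(fcoef _ m + fcoef (fpsX ^+ _)%R m)%R fcoefXn.
have /negbTE -> : m != h * n.+1 by rewrite mulnS; nia.
by rewrite addr0.
Qed.

(** [f i] is the term chosen from the geometric series of [i]; values up to [n] suffice because
    [h i > 0] on [S]. *)
Lemma fcoef_prod_geometric (I : finType) (S : {set I}) (h : I -> nat) n :
  (forall i, i \in S -> 0 < h i) ->
  fcoef (\prod_(i in S) (fpsX ^+ h i / (1 - fpsX ^+ h i)) : fps R)%R n =
  (\sum_(f : {ffun I -> 'I_n.+1} | [set i | f i != ord0] == S)
     (n == (\sum_i f i * h i)%N)%:R)%R.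
Proof.
move=> h0; rewrite big_mkcond.
(* A factor with [i] outside [S] becomes the one-term sum [a = 0], so that distributivity applies
   over all of [I]. *)
transitivity (fcoef (\prod_i \sum_(a : 'I_n.+1 | (a != ord0) == (i \in S))
                       (fpsX ^+ (h i * a) : fps R)) n)%R.
  apply: (@eq_upto_prod n I _ _ _ n (leqnn n)) => i.
  case: ifPn => iS.
    move=> m mn; rewrite (geometric_upto (h0 i iS) mn); congr (fcoef _ m).
    by apply: eq_bigl => a; rewrite /=; case: (a == _).
  rewrite (big_pred1 ord0) ?muln0 ?expr0 // => a.
  by rewrite /=; case: (a == _).
rewrite bigA_distr_big_dep fcoef_sum; apply: eq_big => [f|f _].
  apply/familyP/eqP => [H|<- i].
    by apply/setP => i; rewrite inE; have := H i; rewrite unfold_in => /eqP.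
  by rewrite unfold_in inE.
rewrite (_ : (\prod_i _)%R = (fpsX ^+ (\sum_i f i * h i))%R) ?fcoefXn //.
by elim/big_rec2: _ => // i y1 y2 _ ->; rewrite exprD mulnC.
Qed.

End PowerSeries.

(** * From arrays to reverse plane partitions *)

Section Bijection.

Variables lam mu : seq nat.
Hypothesis lam_part : is_partition lam.

Definition extend (M N : nat) (f : 'I_M * 'I_N -> nat) (a b : nat) : nat :=
  if (insub a, insub b) is (Some i, Some j) then f (i, j) else 0.

Lemma extendE M N (f : 'I_M * 'I_N -> nat) (u : 'I_M * 'I_N) : extend f u.1 u.2 = f u.
Proof. by rewrite /extend !valK; case: u. Qed.

Lemma extend_out M N (f : 'I_M * 'I_N -> nat) a b :
  extend f a b != 0 -> exists u : 'I_M * 'I_N, u.1 = a :> nat /\ u.2 = b :> nat.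
Proof.
rewrite /extend; case: insubP => [i _ <-|//]; case: insubP => [j _ <-|//] _.
by exists (i, j).
Qed.

Lemma growth_rpp_is_rpp A :
  is_rpp [ffun u : skew_cell lam mu => growth_rpp lam A (val u).1 (val u).2].
Proof.
split=> u v E uv; rewrite !ffunE; have := valP v; rewrite !inE => /andP[Dv _].
  by rewrite E; apply: growth_rpp_le; rewrite // -E.
by rewrite E; apply: growth_rpp_le; rewrite // -E.
Qed.

Definition rpp_of A : rpp lam mu :=
  exist (fun p => `[< is_rpp p >]) _ (asboolT (growth_rpp_is_rpp A)).

Lemma rpp_ofE A u : val (rpp_of A) u = growth_rpp lam A (val u).1 (val u).2.
Proof. by rewrite ffunE. Qed.

Definition supported (D : nat -> nat -> bool) (A : nat -> nat -> nat) :=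
  forall a b, ~~ D a b -> A a b = 0.

Definition vanishes_on_mu A :=
  forall u : box lam, u \in diag lam -> in_diag mu u.1 u.2 -> growth_rpp lam A u.1 u.2 = 0.

Lemma rpp_of_size A : supported (in_diag lam) A -> vanishes_on_mu A ->
  rpp_size (rpp_of A) = \sum_(u in diag lam) A u.1 u.2 * hook u.
Proof.
move=> A0 Amu; rewrite -growth_rpp_weight //.
transitivity (\sum_(u : skew_cell lam mu) growth_rpp lam A (val u).1 (val u).2).
  by apply: eq_bigr => u _; exact: rpp_ofE.
rewrite [RHS](bigID (fun u : box lam => in_diag mu u.1 u.2)) /=.
rewrite [X in _ = X + _]big1 => [|u /andP[]]; last exact: Amu.
rewrite add0n -(big_sub (skew_diag lam mu) (fun u : box lam => growth_rpp lam A u.1 u.2)).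
by apply: eq_bigl => u; rewrite !inE.
Qed.

(** The plane partition, together with the zeros on [mu], determines all boundary partitions, and
    [growth_inj] applies. *)
Lemma rpp_of_inj A A' :
  supported (in_diag lam) A -> vanishes_on_mu A ->
  supported (in_diag lam) A' -> vanishes_on_mu A' ->
  rpp_of A = rpp_of A' -> forall a b, A a b = A' a b.
Proof.
move=> A0 Amu A'0 A'mu eqA.
have eqD a b : in_diag lam a b -> growth_rpp lam A a b = growth_rpp lam A' a b.
  move=> Dab; have [aM bH] := in_diag_box lam_part Dab.
  pose u : box lam := (Ordinal aM, Ordinal bH).
  have Du : u \in diag lam by rewrite inE.
  case: (boolP (in_diag mu a b)) => Mab; first by rewrite (Amu u) ?(A'mu u).
  have uS : u \in skew_diag lam mu by rewrite !inE /= Dab.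
  have := congr1 (fun p : rpp lam mu => val p (Sub u uS)) eqA.
  by rewrite /= !ffunE.
have Dbound i j : in_diag lam i j -> i + j < size lam + head 0 lam.
  by case/(in_diag_box lam_part); lia.
apply: (growth_inj (in_diag_le lam_part) Dbound A0 A'0) => -[|i] [|j] Rij nD //.
have [iM jH] := in_diag_box lam_part (Rij : in_diag lam i j).
have [Er Ec] := corner_uniq lam_part (ltnW iM) Rij nD.
apply/funext => r; case: (leqP (minn i.+1 j.+1) r) => [rm|rm].
  by rewrite !growth_eq0.
have := eqD (i - r) (j - r) (in_diag_le lam_part (leq_subr _ _) (leq_subr _ _) Rij).
rewrite /growth_rpp; have -> : (Posz (j - r) - Posz (i - r) = Posz j - Posz i)%R by lia.
by rewrite Er Ec; have -> : i.+1 - (i - r).+1 = r by lia.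
Qed.

Hypothesis mu_part : is_partition mu.

Lemma rpp_of_surj (pi : rpp lam mu) :
  exists A, [/\ supported (in_diag lam) A, vanishes_on_mu A & rpp_of A = pi].
Proof.
(* [pi] is extended by 0 to [mu], which keeps it monotone on [lam]. *)
pose fill (u : box lam) := oapp (val pi) 0 (insub u).
have fillE (u : skew_cell lam mu) : fill (val u) = val pi u by rewrite /fill valK.
have fill0 (u : box lam) : u \notin skew_diag lam mu -> fill u = 0.
  by move=> nu; rewrite /fill insubN.
have /asboolP [pi_row pi_col] := valP pi.
pose p := extend fill.
have p_mono i j i' j' : i <= i' -> j <= j' -> in_diag lam i' j' -> p i j <= p i' j'.
  move=> ii' jj' Dv; have [iM' jH'] := in_diag_box lam_part Dv.
  have iM := leq_ltn_trans ii' iM'; have jH := leq_ltn_trans jj' jH'.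
  pose u : box lam := (Ordinal iM, Ordinal jH).
  (* The comparison of [u] with [v] passes through [w], which is in the skew shape because [u] is
     outside [mu] and [v] is in [lam]. *)
  pose w : box lam := (Ordinal iM, Ordinal jH').
  pose v : box lam := (Ordinal iM', Ordinal jH').
  rewrite (extendE fill u : p i j = _) (extendE fill v : p i' j' = _).
  case: (boolP (u \in skew_diag lam mu)) => uS; last by rewrite fill0.
  have : ~~ in_diag mu i j by move: uS; rewrite !inE => /andP[].
  move=> nM.
  have wS : w \in skew_diag lam mu.
    rewrite !inE /= (in_diag_le lam_part _ _ Dv) //=; apply: contra nM.
    by apply: in_diag_le.
  have vS : v \in skew_diag lam mu.
    by rewrite !inE /= Dv /=; apply: contra nM; apply: in_diag_le.
  rewrite (fillE (Sub u uS)) (fillE (Sub v vS)).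
  by apply: leq_trans (pi_row (Sub u uS) (Sub w wS) _ _) (pi_col (Sub w wS) (Sub v vS) _ _).
have Dbound i j : in_diag lam i j -> i + j < size lam + head 0 lam.
  by case/(in_diag_box lam_part); lia.
have [A [A0 HA]] := growth_surj (in_diag_le lam_part) Dbound p_mono.
have pA a b : in_diag lam a b -> growth_rpp lam A a b = p a b.
  move=> Dab; have [aM _] := in_diag_box lam_part Dab; rewrite /growth_rpp.
  set k : int := (_ - _)%R; have kM : (- Posz (size lam) <= k)%R by rewrite /k; lia.
  have [_ Ec Rr Dr] := square_cornerP lam_part kM.
  move: (Dab); rewrite (in_square_diag lam_part kM erefl) => /andP[ar bc].
  by rewrite HA // /diag_parts ifT; [congr p; lia|lia].
exists A; split=> //.
  move=> u; rewrite inE => Du Mu; rewrite pA // /p extendE fill0 //.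
  by rewrite !inE Du Mu.
apply/val_inj/ffunP => u; rewrite rpp_ofE pA /p ?extendE //.
by have := valP u; rewrite !inE => /andP[].
Qed.

End Bijection.

(** * Arrays with bounded entries *)

Lemma hook_gt0 lam (u : box lam) : is_partition lam -> u \in diag lam -> 0 < hook u.
Proof.
move=> lam_part; rewrite inE => Du; have := Du; rewrite in_diag_conj //.
by move: Du; rewrite /in_diag /hook; lia.
Qed.

Section Arrays.

Variables lam mu : seq nat.
Hypothesis lam_part : is_partition lam.
Hypothesis mu_part : is_partition mu.
Variable n : nat.

Implicit Type f : {ffun box lam -> 'I_n.+1}.

Definition array f : nat -> nat -> nat := extend (fun u => f u : nat).

Definition array_supp f : {set box lam} := [set u | f u != ord0].

Lemma in_array_supp f u : (u \in array_supp f) = (0 < array f u.1 u.2).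
Proof. by rewrite inE /array (extendE (fun u => f u : nat)) lt0n. Qed.

Lemma array_supported f :
  array_supp f \subset diag lam -> supported (in_diag lam) (array f).
Proof.
move=> sub a b nD; apply/eqP; apply: contraNT nD => nz.
have [u [ua ub]] := extend_out nz.
have : u \in array_supp f by rewrite in_array_supp lt0n ua ub.
by move/(fintype.subsetP sub); rewrite inE ua ub.
Qed.

Lemma pleasant_array f : array_supp f \in pleasant_diagrams lam mu ->
  supported (in_diag lam) (array f) /\ vanishes_on_mu lam mu (array f).
Proof.
rewrite inE => /asboolP plS; have A0 := array_supported plS.1.
by split=> //; apply/(pleasant_supportP lam_part mu_part A0 (in_array_supp f)).
Qed.

Definition array_rpp f : rpp lam mu := rpp_of mu lam_part (array f).

Lemma array_rpp_size f : array_supp f \in pleasant_diagrams lam mu ->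
  rpp_size (array_rpp f) = \sum_u f u * hook u.
Proof.
move=> /pleasant_array [A0 Amu]; rewrite rpp_of_size // big_mkcond.
apply: eq_bigr => u _; rewrite -[f u : nat](extendE (fun u => f u : nat)) inE.
by case: ifPn => // /A0; rewrite /array => ->.
Qed.

Lemma array_rpp_inj :
  {in [pred f | array_supp f \in pleasant_diagrams lam mu] &, injective array_rpp}.
Proof.
move=> f f' /pleasant_array [A0 Amu] /pleasant_array [A'0 A'mu] eqG.
apply/ffunP => u; apply/val_inj => /=.
have := rpp_of_inj A0 Amu A'0 A'mu eqG u.1 u.2.
by rewrite /array !extendE.
Qed.

Lemma array_rpp_surj (pi : rpp lam mu) : rpp_size pi = n ->
  exists2 f, array_supp f \in pleasant_diagrams lam mu & array_rpp f = pi.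
Proof.
have [A [A0 Amu <-]] := rpp_of_surj lam_part mu_part pi.
rewrite rpp_of_size // => wA.
(* Hook-lengths are positive, so no entry exceeds the weight [n]. *)
have An (u : box lam) : A u.1 u.2 <= n.
  case: (boolP (u \in diag lam)) => Du; last by rewrite A0 //; move: Du; rewrite inE.
  rewrite -wA (bigD1 u) //= (leq_trans _ (leq_addr _ _)) //.
  by rewrite leq_pmulr // hook_gt0.
pose f : {ffun box lam -> 'I_n.+1} := [ffun u : box lam => inord (A u.1 u.2)].
have fE u : f u = A u.1 u.2 :> nat by rewrite ffunE inordK // ltnS.
have EA : array f = A.
  apply/funext => a; apply/funext => b; case: (boolP (in_diag lam a b)) => Dab.
    have [aM bH] := in_diag_box lam_part Dab.
    by have := extendE (fun u => f u : nat) (Ordinal aM, Ordinal bH); rewrite fE.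
  rewrite A0 //; apply/eqP; apply: contraNT Dab => nz.
  have [u [ua ub]] := extend_out nz; move: nz; rewrite -ua -ub.
  rewrite /array (extendE (fun u => f u : nat)) fE.
  by apply: contraR => /A0 ->.
exists f; last by rewrite /array_rpp EA.
rewrite inE; apply/asboolP; apply/(pleasant_supportP lam_part mu_part A0) => // u.
by rewrite in_array_supp EA.
Qed.

End Arrays.

(** * Comparison of coefficients *)

Local Open Scope ring_scope.

Theorem theorem1p5 (lam mu : seq nat)
    (lam_part : is_partition lam) (mu_part : is_partition mu)
    (mu_lam : part_incl mu lam) :
  fps_sums (fun pi : rpp lam mu => fpsX ^+ rpp_size pi : fps int)
    (\sum_(S in pleasant_diagrams lam mu)
       \prod_(u in S) (fpsX ^+ hook u / (1 - fpsX ^+ hook u))).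
Proof.
move=> n.
(* These finitely many arrays correspond bijectively to the reverse plane partitions of size [n],
   which are the indices with nonzero coefficient. *)
pose good := [set f : {ffun box lam -> 'I_n.+1} |
  (array_supp f \in pleasant_diagrams lam mu) && (n == \sum_u f u * hook u)%N].
have goodP f : (f \in good) =
    (array_supp f \in pleasant_diagrams lam mu) && (n == \sum_u f u * hook u)%N.
  by rewrite in_set.
exists [seq array_rpp mu lam_part f | f <- enum good]; split.
- rewrite map_inj_in_uniq ?enum_uniq // => f f'; rewrite !mem_enum !goodP.
  by move=> /andP[fP _] /andP[f'P _]; apply: array_rpp_inj.
- move=> pi; rewrite fcoefXn pnatr_eq0 eqb0 negbK; apply/mapP/eqP => [[f]|npi].
    by rewrite mem_enum goodP => /andP[fP /eqP nw] ->; rewrite array_rpp_size.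
  have [f fP Ef] := array_rpp_surj lam_part mu_part (esym npi).
  exists f; last by rewrite Ef.
  by rewrite mem_enum goodP fP -(array_rpp_size lam_part mu_part fP) Ef; apply/eqP.
rewrite big_map big_enum_cond fcoef_sum.
transitivity (\sum_(f : {ffun box lam -> 'I_n.+1} |
    array_supp f \in pleasant_diagrams lam mu) (n == \sum_u f u * hook u)%N%:R : int).
  rewrite [RHS](bigID (fun f : {ffun box lam -> 'I_n.+1} => n == \sum_u f u * hook u)%N) /=.
  rewrite [X in _ = _ + X]big1 ?addr0 => [|f /andP[_ /negbTE ->] //].
  apply: eq_big => [f|f]; first by rewrite goodP andbT.
  by rewrite andbT goodP => /andP[fP nw]; rewrite fcoefXn array_rpp_size // nw.
(* Grouping the arrays by support matches the expansion of each product over [S]. *)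
rewrite (partition_big (@array_supp lam n) (mem (pleasant_diagrams lam mu))) //=.
apply: eq_bigr => S SP; rewrite fcoef_prod_geometric => [|u uS]; last first.
  apply: hook_gt0 => //; move: SP; rewrite inE => /asboolP[/fintype.subsetP sub _].
  exact: sub.
apply: eq_bigl => f; case: eqP => [->|]; last by rewrite andbF.
by rewrite SP.
Qed.
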